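(* Let $0<q<1$, let $a,b$ be real with $0<a<q^{-1}$ and $b<q^{-1}$, and let $v\in\mathbb{C}$. Let $(P_n)_{n\ge0}$ be the monic matrix-valued orthogonal polynomials with respect to the inner product $\langle\cdot,\cdot\rangle_W$ with weight matrix $$W(q^x)=a^x\frac{(bq;q)_x}{(q;q)_x}A^x(A^* )^x,\quad x\in\mathbb{N},\qquad A=\begin{pmatrix}q&-v(1-q)\\0&1\end{pmatrix}.$$ Then for all $n\ge0$ $$P_n(z)=N_n^{-1}\begin{pmatrix}\kappa_{11}^np_n(z;aq^2,b;q)&\kappa_{12}^np_{n+1}(z;a,b;q)+\kappa_{11}^n(1-z)v\,p_n(z;aq^2,b;q)\\ \kappa_{21}^np_{n-1}(z;aq^2,b;q)&\kappa_{22}^np_n(z;a,b;q)+\kappa_{21}^n(1-z)v\,p_{n-1}(z;aq^2,b;q)\end{pmatrix},$$ where $$N_n=\begin{pmatrix}1&\alpha\\0&1\end{pmatrix},\quad \alpha=\frac{1-q^n+aq^{n+1}-abq^{2n+2}}{1-abq^{2n+2}}\,v=v\left(1+q^n\frac{aq-1}{1-abq^{2n+2}}\right),$$ and $$\kappa_{11}^n=(-1)^nq^{\binom n2}\frac{(aq^3;q)_n}{(abq^{n+3};q)_n},\qquad \kappa_{12}^n=(-1)^{n+1}v\,q^{\binom{n+1}2}\frac{(aq;q)_{n+1}}{(abq^{n+2};q)_{n+1}},$$ $$\kappa_{21}^n=(-1)^n\xi_n\,a\overline{v}\,q^{\binom n2-n+2}\frac{(1-q^n)(1-bq^n)}{(1-aq)(1-aq^2)}\frac{(aq;q)_n}{(abq^{n+1};q)_n},\qquad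 \kappa_{22}^n=(-1)^n\xi_n\,q^{\binom n2}\frac{(aq;q)_n}{(abq^{n+1};q)_n},$$ $$\xi_n=\left(1+aq|v|^2\frac{(1-q^n)(1-bq^n)}{(1-abq^{n+1})(1-aq^{n+1})}\right)^{-1}.$$
   Context: $\mathbb{N}=\{0,1,2,\dots\}$; $(c;q)_n=\prod_{i=0}^{n-1}(1-cq^i)$. The little $q$-Jacobi polynomials are $$p_n(z;a,b;q)=\sum_{k=0}^n\frac{(q^{-n};q)_k(abq^{n+1};q)_k}{(q;q)_k(aq;q)_k}(qz)^k .$$ For $n=0$ the terms containing $p_{-1}$ are zero (note $\kappa_{21}^0=0$). The inner product on polynomials with coefficients in $\mathrm{Mat}_2(\mathbb{C})$ is $\langle P,Q\rangle_W=\sum_{x=0}^\infty q^xP(q^x)W(q^x)Q(q^x)^*$. The monic orthogonal polynomials with respect to $W$ are the unique sequence $(P_n)_{n\ge0}$ with $P_n$ of degree $n$ with leading coefficient $I$ and $\langle P_m,P_n\rangle_W=0$ for $m\neq n$. *)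

(* Defs.v *)
From HB Require Import structures.
From mathcomp Require Import all_boot all_order all_algebra.
From mathcomp Require Import all_classical all_reals all_analysis.
From mathcomp Require Export complex.

Set Implicit Arguments.
Unset Strict Implicit.
Unset Printing Implicit Defensive.

Import Order.TTheory GRing.Theory Num.Theory.
Import numFieldNormedType.Exports.

Local Open Scope classical_set_scope.
Local Open Scope ring_scope.
Local Open Scope sesquilinear_scope.

Definition qpoch (F : fieldType) (q c : F) (n : nat) : F :=
  \prod_(i < n) (1 - c * q ^+ i).

Definition little_q_jacobi (F : fieldType) (q a b : F) (n : nat) (z : F) : F :=
  \sum_(k < n.+1)
    qpoch q (q ^- n) k * qpoch q (a * b * q ^+ n.+1) k
    / (qpoch q q k * qpoch q (a * q) k) * (q * z) ^+ k.

Definition mx22 (F : fieldType) (m11 m12 m21 m22 : F) : 'M[F]_2 :=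
  \matrix_(i, j) if i == 0 then (if j == 0 then m11 else m12)
                 else (if j == 0 then m21 else m22).

Section MatrixOrthogonality.
Variable C : numClosedFieldType.
Implicit Types (q a b v : C) (W : nat -> 'M[C]_2) (P Q : {poly 'M[C]_2}).

(* [W x] stands for the value of the weight at the point [q ^+ x].  The sum
   is the limit of its partial sums for the norm topology on ['M[C]_2]. *)
Definition inner_product q W P Q : 'M[C]_2 :=
  limn (series (fun x : nat =>
    q ^+ x *: (P.[(q ^+ x)%:M] *m W x *m Q.[(q ^+ x)%:M] ^t*))).

Definition monic_orthogonal q W (P : nat -> {poly 'M[C]_2}) : Prop :=
  (forall n, size (P n) = n.+1 /\ P n \is monic) /\
  (forall m n, m != n -> inner_product q W (P m) (P n) = 0).

Definition matA q v : 'M[C]_2 := mx22 q (- v * (1 - q)) 0 1.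

Definition weight q a b v (x : nat) : 'M[C]_2 :=
  (a ^+ x * (qpoch q (b * q) x / qpoch q q x))
    *: (matA q v ^+ x *m (matA q v ^t*) ^+ x).

Definition alpha q a b v n : C :=
  (1 - q ^+ n + a * q ^+ n.+1 - a * b * q ^+ (2 * n + 2))
  / (1 - a * b * q ^+ (2 * n + 2)) * v.

Definition matN q a b v n : 'M[C]_2 := mx22 1 (alpha q a b v n) 0 1.

Definition xi q a b v n : C :=
  (1 + a * q * `|v| ^+ 2 * ((1 - q ^+ n) * (1 - b * q ^+ n)
     / ((1 - a * b * q ^+ n.+1) * (1 - a * q ^+ n.+1))))^-1.

Definition kappa11 q a b n : C :=
  (-1) ^+ n * q ^+ 'C(n, 2)
  * (qpoch q (a * q ^+ 3) n / qpoch q (a * b * q ^+ (n + 3)) n).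

Definition kappa12 q a b v n : C :=
  (-1) ^+ n.+1 * v * q ^+ 'C(n.+1, 2)
  * (qpoch q (a * q) n.+1 / qpoch q (a * b * q ^+ (n + 2)) n.+1).

(* The exponent of [q] is an integer: ['C(n, 2) - n] is negative for
   [n = 1, 2]. *)
Definition kappa21 q a b v n : C :=
  (-1) ^+ n * xi q a b v n * a * v^* * q ^ ('C(n, 2)%:Z - n%:Z + 2)
  * ((1 - q ^+ n) * (1 - b * q ^+ n) / ((1 - a * q) * (1 - a * q ^+ 2)))
  * (qpoch q (a * q) n / qpoch q (a * b * q ^+ n.+1) n).

Definition kappa22 q a b v n : C :=
  (-1) ^+ n * xi q a b v n * q ^+ 'C(n, 2)
  * (qpoch q (a * q) n / qpoch q (a * b * q ^+ n.+1) n).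

(* For [n = 0] the polynomial of index [n.-1] is [p_0] and not [p_(-1) = 0],
   but it only occurs multiplied by [kappa21], which is then [0]. *)
Definition explicit_mvop q a b v n (z : C) : 'M[C]_2 :=
  let p := little_q_jacobi q in
  let k11 := kappa11 q a b n in
  let k12 := kappa12 q a b v n in
  let k21 := kappa21 q a b v n in
  let k22 := kappa22 q a b v n in
  invmx (matN q a b v n) *m
  mx22 (k11 * p (a * q ^+ 2) b n z)
       (k12 * p a b n.+1 z + k11 * (1 - z) * v * p (a * q ^+ 2) b n z)
       (k21 * p (a * q ^+ 2) b n.-1 z)
       (k22 * p a b n z + k21 * (1 - z) * v * p (a * q ^+ 2) b n.-1 z).

End MatrixOrthogonality.

(* Main.v *)
From HB Require Import structures.
Require Import Defs.
From mathcomp Require Import all_boot all_order all_algebra.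
From mathcomp Require Import all_classical all_reals all_analysis.
From mathcomp Require Import ring lra.

(** Write [p_n] for the little q-Jacobi polynomials with parameters [a, b] and
    [p2_n] for those with parameters [a q^2, b].  At [z = q^x] the power [A^x]
    is the value of the polynomial matrix [T(z) = ((z, -v(1-z)), (0, 1))], so
    the matrix weight is a positive scalar mass times [T(z)] times its
    adjoint.  Right multiplication by [T] makes the bracketed matrix [M_n] of
    the claim collapse to
    [((k11 z p2_n, k12 p_(n+1)), (k21 z p2_(n-1), k22 p_n))]
    ([mvop_numerator_root]), and since [z^2] times the scalar mass with
    parameters [a, b] is the mass with parameters [a q^2, b], every entry of
    the inner product of [M_n] with a matrix polynomial of degree less than
    [n] is a sum of scalar orthogonality integrals, all zero except for one
    pair of multiples of squared norms, which cancels by the choice of [k21]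
    ([weight_form_numerator]).  The first two coefficients of the scalar
    polynomials show that [M_n] has degree [n] and leading coefficient [N_n]
    ([coef_mvop_numerator]); the normalisation [xi_n] is what makes its last
    diagonal entry equal to [1].

    Hence [P_n - N_n^-1 M_n] has degree less than [n] and is orthogonal to
    every polynomial of degree less than [n], in particular to itself.  The
    inner product is definite, because the mass is positive at the infinitely
    many points [q^x] and [det T] is not zero, so the difference vanishes
    ([monic_orthogonal_explicit]).

    The scalar facts are algebraic consequences of the moments.  A telescoping
    sum gives [(1-c) S(c) = (1-bcq) S(cq)] for
    [S(c) = sum_x c^x (bq;q)_x / (q;q)_x] ([jacobi_sum_qshift]), so the [j]-th
    moment is proportional to [(aq;q)_j / (abq^2;q)_j].  Consequently the
    moment functional of [(1-z) f(z)] is proportional to the functional with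
    parameters [a, bq] of [f(qz)] ([jacobi_functional_shift]).  Dividing a
    test polynomial by [1 - z] repeatedly then reduces orthogonality and the
    value of the norm to the q-Chu-Vandermonde sum [q_vandermonde]
    ([jacobi_functional_Mqhyp]). *)

Set Implicit Arguments.
Unset Strict Implicit.
Unset Printing Implicit Defensive.

Import Order.TTheory GRing.Theory Num.Theory.
Import numFieldNormedType.Exports.

Local Open Scope ring_scope.
Local Open Scope classical_set_scope.

(* [field] leaves a boolean conjunction of nonvanishing conditions. *)
Ltac field_nz := field; do ?[apply/andP; split]; assumption.

(** * q-shifted factorials and the q-Chu-Vandermonde sum *)

Section QPochhammer.
Variables (F : fieldType) (q : F).
Implicit Types c : F.

Lemma qpoch0 c : qpoch q c 0 = 1.
Proof. by rewrite /qpoch big_ord0. Qed.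

Lemma qpochS c n : qpoch q c n.+1 = qpoch q c n * (1 - c * q ^+ n).
Proof. by rewrite /qpoch big_ord_recr. Qed.

Lemma qpochD c m n :
  qpoch q c (m + n) = qpoch q c m * qpoch q (c * q ^+ m) n.
Proof.
elim: n => [|n IHn]; first by rewrite addn0 qpoch0 mulr1.
by rewrite addnS !qpochS IHn exprD !mulrA.
Qed.

Lemma qpochSl c n : qpoch q c n.+1 = (1 - c) * qpoch q (c * q) n.
Proof. by rewrite -add1n qpochD qpochS qpoch0 mul1r expr0 mulr1 expr1. Qed.

Lemma qpoch_neq0 c n : (forall i, 1 - c * q ^+ i != 0) -> qpoch q c n != 0.
Proof. by move=> c_reg; apply/prodf_neq0 => i _. Qed.

Lemma qpoch_eq0 c n i : (i < n)%N -> c * q ^+ i = 1 -> qpoch q c n = 0.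
Proof.
move=> lt_in eq1; apply/eqP/prodf_eq0; exists (Ordinal lt_in) => //=.
by rewrite eq1 subrr.
Qed.

End QPochhammer.

Section QVandermonde.
Variables (F : fieldType) (q : F).
Hypotheses (q_neq0 : q != 0) (q_reg : forall i, 1 - q * q ^+ i != 0).

(** This is [(-1)^k q^(k(k-1)/2)] times the Gaussian binomial coefficient; the
    form with [q^-n] is the one that occurs in the hypergeometric series. *)
Definition signed_qbinomial n k : F :=
  qpoch q (q ^- n) k * (q ^+ n) ^+ k / qpoch q q k.

Let qq_neq0 k : qpoch q q k != 0. Proof. exact: qpoch_neq0. Qed.

Lemma signed_qbinomial0 n : signed_qbinomial n 0 = 1.
Proof. by rewrite /signed_qbinomial !qpoch0 expr0 mulr1 divr1. Qed.

Lemma signed_qbinomialS n k :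
  signed_qbinomial n k.+1 =
  signed_qbinomial n k * (q ^+ n - q ^+ k) / (1 - q * q ^+ k).
Proof.
rewrite /signed_qbinomial !qpochS exprSr; have := qq_neq0 k; have := q_reg k.
move=> qk_neq0 ?; have qn_neq0 : q ^+ n != 0 by rewrite expf_neq0.
field_nz.
Qed.

Lemma signed_qbinomial_pascal n k :
  signed_qbinomial n.+1 k.+1 =
  signed_qbinomial n k.+1 - q ^+ n * signed_qbinomial n k.
Proof.
elim: k => [|k IHk].
  rewrite !signed_qbinomialS !signed_qbinomial0 exprS expr0.
  by have := q_reg 0; rewrite expr0 mulr1 => q1; field_nz.
rewrite signed_qbinomialS IHk [signed_qbinomial n k.+2]signed_qbinomialS.
rewrite signed_qbinomialS.
have := q_reg k; have := q_reg k.+1; rewrite !exprS => q1 q2.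
field_nz.
Qed.

Lemma signed_qbinomial_small n : signed_qbinomial n n.+1 = 0.
Proof. by rewrite signed_qbinomialS subrr mulr0 mul0r. Qed.

Lemma signed_qbinomial_diag n :
  signed_qbinomial n n = (-1) ^+ n * q ^+ 'C(n, 2).
Proof.
elim: n => [|n IHn]; first by rewrite signed_qbinomial0 mulr1.
rewrite signed_qbinomial_pascal signed_qbinomial_small IHn binS bin1.
by rewrite exprD exprS; ring.
Qed.

(** The terminating q-Chu-Vandermonde sum with parameters [A] and [A E], in the
    form that allows [A = 0].  The Pascal rule expresses the sum for [n+1]
    through the sums for [n] with parameters [A] and [A q], which gives an
    induction on [n] for all [A] at once. *)
Lemma q_vandermonde n A E : (forall i, 1 - A * E * q ^+ i != 0) ->
  \sum_(k < n.+1)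
     signed_qbinomial n k * (qpoch q A k / qpoch q (A * E) k) * E ^+ k
  = qpoch q E n / qpoch q (A * E) n.
Proof.
elim: n A => [|n IHn] A AE_reg.
  rewrite big_ord_recl big_ord0 signed_qbinomial0 !qpoch0.
  by rewrite divr1 expr0 !mulr1 addr0.
have AqE_reg i : 1 - (A * q) * E * q ^+ i != 0.
  by move: (AE_reg i.+1); rewrite exprS; congr (_ != 0); ring.
pose g k := qpoch q A k / qpoch q (A * E) k * E ^+ k.
have gS k : g k.+1 = E * (1 - A) / (1 - A * E)
    * (qpoch q (A * q) k / qpoch q ((A * q) * E) k * E ^+ k).
  rewrite /g !qpochSl exprS [A * E * q]mulrAC.
  have := qpoch_neq0 k AqE_reg; have := AE_reg 0.
  by rewrite expr0 mulr1 => h1 h2; field; rewrite h1 h2.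
have sum_n : \sum_(k < n.+2) signed_qbinomial n k * g k
           = qpoch q E n / qpoch q (A * E) n.
  rewrite big_ord_recr /= signed_qbinomial_small mul0r addr0 -IHn //.
  by apply: eq_bigr => k _; rewrite /g mulrA.
transitivity (qpoch q E n / qpoch q (A * E) n
  - q ^+ n * (E * (1 - A) / (1 - A * E))
    * (qpoch q E n / qpoch q ((A * q) * E) n)).
  rewrite -sum_n -(IHn _ AqE_reg) mulr_sumr.
  rewrite big_ord_recl [in RHS]big_ord_recl !signed_qbinomial0 -addrA.
  congr (_ + _); first by rewrite !mul1r.
  rewrite -sumrB; apply: eq_bigr => k _; rewrite lift0.
  rewrite signed_qbinomial_pascal -mulrA -/(g k.+1) mulrBl; congr (_ - _).
  by rewrite gS; ring.
have h0 := qpoch_neq0 n AE_reg; have h1 := qpoch_neq0 n AqE_reg.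
have h2 := AE_reg n; have h3 := AE_reg 0; rewrite expr0 mulr1 in h3.
have : qpoch q (A * E) n * (1 - A * E * q ^+ n)
     = (1 - A * E) * qpoch q ((A * q) * E) n.
  by rewrite -qpochS qpochSl; congr (_ * qpoch q _ _); ring.
move=> split_AE; rewrite !qpochS.
have -> : qpoch q ((A * q) * E) n
        = qpoch q (A * E) n * (1 - A * E * q ^+ n) / (1 - A * E).
  by rewrite split_AE [RHS]mulrC mulKf.
field_nz.
Qed.

End QVandermonde.

(** * Little q-Jacobi polynomials and their moment functional *)

Lemma coef_comp_scaleX (F : comNzRingType) (c : F) (f : {poly F}) k :
  (f \Po (c *: 'X))`_k = c ^+ k * f`_k.
Proof.
rewrite comp_polyE coef_sum.
transitivity (\sum_(i < size f) (c ^+ i * f`_i) * (k == i)%:R).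
  by apply: eq_bigr => i _; rewrite exprZn !coefZ coefXn mulrA [_ * c ^+ _]mulrC.
have [lt_k|le_k] := ltnP k (size f).
  rewrite (bigD1 (Ordinal lt_k)) //= eqxx mulr1 big1 ?addr0 // => i ne_ik.
  by rewrite eq_sym [_ == _](negbTE ne_ik) mulr0.
rewrite nth_default // mulr0 big1 // => i _.
by rewrite gtn_eqF ?mulr0 // (leq_trans (ltn_ord i)).
Qed.

Section MomentFunctional.
Variable F : fieldType.
Implicit Types (m : nat -> F) (f g : {poly F}).

Definition moment_functional m f : F := \sum_(j < size f) f`_j * m j.

Lemma moment_functional_widen m f N : (size f <= N)%N ->
  moment_functional m f = \sum_(j < N) f`_j * m j.
Proof.
move=> le_fN; rewrite /moment_functional (big_ord_widen N (fun j => f`_j * m j)) //.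
rewrite big_mkcond; apply: eq_bigr => j _; case: ltnP => // le_f.
by rewrite nth_default ?mul0r.
Qed.

Lemma moment_functional_scalar m : scalar (moment_functional m).
Proof.
move=> c f g; pose N := maxn (size f) (size g).
have le_fN : (size f <= N)%N by rewrite leq_maxl.
have le_gN : (size g <= N)%N by rewrite leq_maxr.
have le_cfN : (size (c *: f + g)%R <= N)%N.
  by rewrite (leq_trans (size_polyD _ _)) // geq_max le_gN
             (leq_trans (size_scale_leq _ _)).
rewrite !(moment_functional_widen _ (N := N)) // mulr_sumr -big_split /=.
by apply: eq_bigr => j _; rewrite coefD coefZ mulrDl mulrA.
Qed.

HB.instance Definition _ m :=
  GRing.isLinear.Build F {poly F} F *%R (moment_functional m)
    (moment_functional_scalar m).

Lemma moment_functionalXM m f :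
  moment_functional m ('X * f) = moment_functional (fun j => m j.+1) f.
Proof.
rewrite (@moment_functional_widen _ _ (size f).+1); last first.
  by rewrite mulrC (leq_trans (size_polyMleq _ _)) // size_polyX addn2.
rewrite big_ord_recl coefXM mul0r add0r.
by apply: eq_bigr => j _; rewrite coefXM lift0.
Qed.

Lemma eq_moment_functional c m1 m2 f : (forall j, m1 j = c * m2 j) ->
  moment_functional m1 f = c * moment_functional m2 f.
Proof.
by move=> eq_m; rewrite mulr_sumr; apply: eq_bigr => j _; rewrite eq_m mulrCA.
Qed.

Lemma moment_functional_comp_scaleX m c f :
  moment_functional m (f \Po (c *: 'X)) =
  moment_functional (fun j => c ^+ j * m j) f.
Proof.
have sz : (size (f \Po (c *: 'X)) <= size f)%N.
  by apply/leq_sizeP => j le_j; rewrite coef_comp_scaleX nth_default ?mulr0.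
rewrite (moment_functional_widen _ sz); apply: eq_bigr => j _.
by rewrite coef_comp_scaleX -mulrA mulrCA.
Qed.

End MomentFunctional.

Section LittleQJacobi.
Variables (F : fieldType) (q : F).
Hypotheses (q_neq0 : q != 0) (q_reg : forall i, 1 - q * q ^+ i != 0).
Implicit Types (a b A : F) (f : {poly F}).

(** The [j]-th moment of the little q-Jacobi mass [(aq)^x (bq;q)_x / (q;q)_x]
    at [q^x], divided by the total mass. *)
Definition jacobi_moment a b j : F :=
  qpoch q (a * q) j / qpoch q (a * b * q ^+ 2) j.

Definition jacobi_functional a b := moment_functional (jacobi_moment a b).

HB.instance Definition _ a b := GRing.Linear.copy (jacobi_functional a b)
  (moment_functional (jacobi_moment a b)).

(** The terminating 2phi1 with numerator parameters [q^-n] and [A], denominator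
    parameter [a q] and argument [q z]. Keeping [A] independent of [n] lets the
    degree of the test polynomial and [n] vary separately in
    [jacobi_functional_Mqhyp]. *)
Definition qhyp_poly a A n : {poly F} :=
  \poly_(k < n.+1) (qpoch q (q ^- n) k * qpoch q A k
                    / (qpoch q q k * qpoch q (a * q) k) * q ^+ k).

Definition jacobi_poly a b n := qhyp_poly a (a * b * q ^+ n.+1) n.

(** The inverse of the leading coefficient of [jacobi_poly a b n]. *)
Definition jacobi_monic_factor a b n : F :=
  (-1) ^+ n * q ^+ 'C(n, 2)
    * (qpoch q (a * q) n / qpoch q (a * b * q ^+ n.+1) n).

(** The value of the functional on [z^n p_n]. *)
Definition jacobi_norm a b n : F :=
  (- a) ^+ n * q ^+ 'C(n.+1, 2) * (qpoch q (b * q) n * qpoch q q n)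
  / qpoch q (a * b * q ^+ 2) (n + n).

Lemma horner_jacobi_poly a b n z :
  (jacobi_poly a b n).[z] = little_q_jacobi q a b n z.
Proof.
rewrite horner_poly; apply: eq_bigr => k _.
by rewrite exprMn !mulrA.
Qed.

(** At [q^x] the factor [1 - q^x] cancels the last factor of [(q;q)_x]; the
    shift of the summation index then turns [b] into [b q] and [f(z)] into
    [f(qz)].  On moments this is a two-term identity. *)
Lemma jacobi_functional_shift a b f :
  (forall i, 1 - a * b * q ^+ 2 * q ^+ i != 0) ->
  jacobi_functional a b ((1 - 'X) * f) =
  a * q * (1 - b * q) / (1 - a * b * q ^+ 2)
  * jacobi_functional a (b * q) (f \Po (q *: 'X)).
Proof.
move=> ab_reg; rewrite /jacobi_functional mulrBl mul1r linearB /=.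
rewrite moment_functionalXM moment_functional_comp_scaleX.
rewrite -sumrB mulr_sumr; apply: eq_bigr => j _; rewrite -mulrBr mulrCA.
congr (_ * _); rewrite /jacobi_moment qpochS.
have h0 := ab_reg 0; rewrite expr0 mulr1 in h0.
have hj := ab_reg j; have hp := qpoch_neq0 j ab_reg.
have hp' : qpoch q (a * b * q ^+ 2 * q) j != 0.
  by apply: qpoch_neq0 => i; rewrite -mulrA -exprS.
have -> : a * (b * q) * q ^+ 2 = a * b * q ^+ 2 * q by ring.
have -> : qpoch q (a * b * q ^+ 2 * q) j
   = qpoch q (a * b * q ^+ 2) j * (1 - a * b * q ^+ 2 * q ^+ j)
     / (1 - a * b * q ^+ 2).
  by rewrite -qpochS qpochSl [RHS]mulrC mulKf.
rewrite qpochS; field_nz.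
Qed.

(** Multiplying the mass at [q^x] by [q^(2x)] replaces [a] by [a q^2]. *)
Lemma jacobi_functionalX2 a b f :
  (forall i, 1 - a * b * q ^+ 2 * q ^+ i != 0) ->
  jacobi_functional a b ('X^2 * f) =
  jacobi_moment a b 2 * jacobi_functional (a * q ^+ 2) b f.
Proof.
move=> ab_reg; rewrite /jacobi_functional expr2 -mulrA !moment_functionalXM.
apply: eq_moment_functional => j; rewrite /jacobi_moment -addn2 addnC !qpochD.
have -> : a * q ^+ 2 * q = a * q * q ^+ 2 by ring.
have -> : a * q ^+ 2 * b * q ^+ 2 = a * b * q ^+ 2 * q ^+ 2 by ring.
by rewrite mulf_div.
Qed.

(** Term by term, the moments turn the 2phi1 at [q^s z] into the series summed
    by [q_vandermonde]. *)
Lemma jacobi_functional_qhyp a b A n s :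
  (forall i, 1 - a * q * q ^+ i != 0) ->
  (forall i, 1 - a * b * q ^+ 2 * q ^+ i != 0) ->
  A * (q ^+ s.+1 / q ^+ n) = a * b * q ^+ 2 ->
  jacobi_functional a b (qhyp_poly a A n \Po (q ^+ s *: 'X)) =
  qpoch q (q ^+ s.+1 / q ^+ n) n / qpoch q (a * b * q ^+ 2) n.
Proof.
move=> a_reg ab_reg eq_AE.
have AE_reg i : 1 - A * (q ^+ s.+1 / q ^+ n) * q ^+ i != 0 by rewrite eq_AE.
rewrite -eq_AE -(q_vandermonde q_neq0 q_reg _ AE_reg) eq_AE.
rewrite /jacobi_functional moment_functional_comp_scaleX.
rewrite (moment_functional_widen _ (size_poly _ _)); apply: eq_bigr => k _.
rewrite coef_poly ltn_ord /jacobi_moment /signed_qbinomial.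
have h1 := qpoch_neq0 k a_reg; have h2 := qpoch_neq0 k ab_reg.
have h3 := qpoch_neq0 k q_reg.
have h4 : q ^+ n ^+ k != 0 by rewrite !expf_neq0.
rewrite expr_div_n [q ^+ s.+1]exprS exprMn; field_nz.
Qed.

(** Induction on the degree bound [d]: write [f = f(1) - (1-z) g]. The constant
    contributes zero when [d > 0], because its Vandermonde value then has the
    factor [1 - q^0], and the second term is the same statement for [g(qz)]
    with [b q], [s + 1] and [d - 1]. The shift keeps both [s + d] and the
    parameter [a b q^(d+1)], hence the hypergeometric polynomial, fixed. *)
Lemma jacobi_functional_Mqhyp a b s d f :
  (forall i, 1 - a * q * q ^+ i != 0) ->
  (forall i, 1 - a * b * q ^+ 2 * q ^+ i != 0) ->
  (size f <= d.+1)%N ->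
  jacobi_functional a b
    (f * (qhyp_poly a (a * b * q ^+ d.+1) (s + d) \Po (q ^+ s *: 'X))) =
  f`_d * ((- a) ^+ d * q ^+ 'C(d.+1, 2)
          * (qpoch q (b * q) d * qpoch q q (s + d))
          / qpoch q (a * b * q ^+ 2) (s + d + d)).
Proof.
move=> a_reg; elim: d b s f => [|d IHd] b s f ab_reg le_f.
  rewrite (size1_polyC le_f) mul_polyC linearZ /= coefC eqxx.
  rewrite addn0 jacobi_functional_qhyp //; last first.
    by rewrite [q ^+ s.+1]exprS mulfK ?expf_neq0 // expr1; ring.
  rewrite [q ^+ s.+1]exprS mulfK ?expf_neq0 // bin_small //.
  by rewrite !expr0 qpoch0 !mul1r addn0.
have root_g : root (f - f.[1]%:P) 1.
  by rewrite rootE hornerD hornerN hornerC subrr.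
have [g def_g] := factor_theorem _ _ root_g.
have def_f : f = f.[1]%:P - (1 - 'X) * g.
  by rewrite -mulNr opprB mulrC -def_g addrC subrK.
have le_g : (size g <= d.+1)%N.
  have [-> | g_neq0] := eqVneq g 0; first by rewrite size_poly0.
  have : (size (f - f.[1]%:P)%R <= d.+2)%N.
    rewrite (leq_trans (size_polyD _ _)) // geq_max le_f size_polyN.
    by rewrite (leq_trans (size_polyC_leq1 _)).
  by rewrite def_g size_Mmonic ?monicXsubC // size_XsubC addn2.
have f_d : f`_d.+1 = g`_d.
  have := congr1 (fun h : {poly F} => h`_d.+1) def_g.
  rewrite coefB coefC subr0 mulrBr coefB coefMX coefMC mulr1 => -> /=.
  by rewrite [g`_d.+1]nth_default ?subr0.
have abq_reg i : 1 - a * (b * q) * q ^+ 2 * q ^+ i != 0.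
  by move: (ab_reg i.+1); rewrite [q ^+ i.+1]exprS; congr (_ != 0); ring.
set p := _ \Po _; rewrite {1}def_f mulrBl linearB /= -mulrA.
have p_scale : p \Po (q *: 'X)
    = qhyp_poly a (a * (b * q) * q ^+ d.+1) (s.+1 + d) \Po (q ^+ s.+1 *: 'X).
  rewrite /p -comp_polyA comp_polyZ comp_polyX scalerA -exprSr addSnnS.
  by congr (qhyp_poly a _ _ \Po _); rewrite [in LHS]exprS; ring.
rewrite jacobi_functional_shift // comp_polyM p_scale IHd //; last first.
  apply/leq_sizeP => j le_j.
  by rewrite coef_comp_scaleX nth_default ?mulr0 ?(leq_trans le_g).
rewrite mul_polyC linearZ /= jacobi_functional_qhyp //; last first.
  have qn_neq0 : q ^+ (s + d.+1) != 0 by rewrite expf_neq0.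
  rewrite mulrA; apply: (canLR (mulfK qn_neq0)).
  by rewrite !addnS !exprS exprD; ring.
rewrite (@qpoch_eq0 _ _ _ _ d); first last.
- by rewrite mulrAC -exprD addSnnS mulfV // expf_neq0.
- by rewrite addnS ltnS leq_addl.
rewrite mul0r mulr0 sub0r coef_comp_scaleX f_d.
have h0 := ab_reg 0; rewrite expr0 mulr1 in h0.
have hp := qpoch_neq0 (s.+1 + d + d) abq_reg.
have -> : (s + d.+1 + d.+1)%N = (s.+1 + d + d).+1 by rewrite !addnS !addSn.
have -> : (s + d.+1)%N = (s.+1 + d)%N by rewrite addSnnS.
rewrite [qpoch q (a * b * _) _]qpochSl [qpoch q (b * q) _]qpochSl.
rewrite ['C(d.+2, 2)]binS bin1.
have -> : a * b * q ^+ 2 * q = a * (b * q) * q ^+ 2 by ring.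
rewrite [q ^+ (_ + d.+1)]exprD [q ^+ d.+1]exprS [(- a) ^+ d.+1]exprS; field_nz.
Qed.

(** Orthogonality is the case [f`_n = 0]; only the top coefficient of a test
    polynomial of degree [n] meets the norm of [p_n]. *)
Lemma jacobi_functional_Mjacobi a b n f :
  (forall i, 1 - a * q * q ^+ i != 0) ->
  (forall i, 1 - a * b * q ^+ 2 * q ^+ i != 0) ->
  (size f <= n.+1)%N ->
  jacobi_functional a b (f * jacobi_poly a b n) = f`_n * jacobi_norm a b n.
Proof.
move=> a_reg ab_reg le_f.
have := jacobi_functional_Mqhyp 0 a_reg ab_reg le_f.
by rewrite expr0 scale1r comp_polyXr add0n.
Qed.

Lemma qpoch_abSn_neq0 a b n :
  (forall i, 1 - a * b * q ^+ 2 * q ^+ i != 0) ->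
  qpoch q (a * b * q ^+ n.+1) n != 0.
Proof.
case: n => [|n] ab_reg; first by rewrite qpoch0 oner_neq0.
apply: qpoch_neq0 => i; move: (ab_reg (n + i)%N).
by rewrite exprD [q ^+ n.+2]exprS [q ^+ n.+1]exprS; congr (_ != 0); ring.
Qed.

Lemma jacobi_poly_lead a b n :
  (forall i, 1 - a * q * q ^+ i != 0) ->
  (forall i, 1 - a * b * q ^+ 2 * q ^+ i != 0) ->
  jacobi_monic_factor a b n * (jacobi_poly a b n)`_n = 1.
Proof.
move=> a_reg ab_reg; rewrite /jacobi_monic_factor coef_poly ltnSn.
have h1 := qpoch_neq0 n a_reg; have h2 := qpoch_abSn_neq0 n ab_reg.
have h3 := qpoch_neq0 n q_reg; have hq : q ^+ n ^+ n != 0 by rewrite !expf_neq0.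
have hC : q ^+ 'C(n, 2) != 0 by rewrite expf_neq0.
have hs : qpoch q (q ^- n) n
     = (-1) ^+ n * q ^+ 'C(n, 2) * qpoch q q n / q ^+ n ^+ n.
  by rewrite -signed_qbinomial_diag // /signed_qbinomial; field_nz.
have hqn : q ^+ n ^+ n = q ^+ 'C(n, 2) * q ^+ 'C(n, 2) * q ^+ n.
  rewrite -exprM -!exprD; congr (_ ^+ _); elim: (n) => [|m IHm] //.
  by rewrite mulSn mulnS IHm binS bin1; ring.
have hqn0 : q ^+ n != 0 by rewrite expf_neq0.
have sgn2 : (-1) ^+ n * (-1) ^+ n = 1 :> F by rewrite -expr2 sqrr_sign.
rewrite hs hqn -[RHS]sgn2; field_nz.
Qed.

Lemma jacobi_poly_coefS a b n k : (k < n)%N ->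
  (forall i, 1 - a * q * q ^+ i != 0) ->
  (jacobi_poly a b n)`_k.+1
    * ((1 - q * q ^+ k) * (1 - a * q * q ^+ k) * q ^+ n) =
  (jacobi_poly a b n)`_k
    * ((q ^+ n - q ^+ k) * (1 - a * b * q ^+ n.+1 * q ^+ k) * q).
Proof.
move=> lt_kn a_reg; rewrite !coef_poly ltnS lt_kn ltnS ltnW //.
rewrite !qpochS [q ^+ k.+1]exprSr.
have h1 := qpoch_neq0 k a_reg; have h3 := qpoch_neq0 k q_reg.
have hq : q ^+ n != 0 by rewrite expf_neq0.
have h4 := a_reg k; have h5 := q_reg k.
field_nz.
Qed.

(** The factor ['X] makes the coefficient of degree [n - 1] appear as one of
    degree [n], which is [0] when [n = 0]. *)
Lemma jacobi_poly_sublead a b n :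
  (forall i, 1 - a * q * q ^+ i != 0) ->
  (forall i, 1 - a * b * q ^+ 2 * q ^+ i != 0) ->
  jacobi_monic_factor a b n * ('X * jacobi_poly a b n)`_n =
  (1 - q ^+ n) * (1 - a * q ^+ n) / ((q - 1) * (1 - a * b * q ^+ (n + n))).
Proof.
move=> a_reg ab_reg; rewrite coefXM.
case: n => [|n] /=; first by rewrite expr0 subrr mulr0 !mul0r.
have := jacobi_poly_coefS b (ltnSn n) a_reg.
have := jacobi_poly_lead n.+1 a_reg ab_reg.
set L := jacobi_monic_factor _ _ _; set p := jacobi_poly _ _ _ => lead coefS.
have q1 : q - 1 != 0.
  by rewrite -opprB oppr_eq0; move: (q_reg 0); rewrite expr0 mulr1.
have qn : q ^+ n != 0 by rewrite expf_neq0.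
have ab_n : 1 - a * b * q ^+ (n.+1 + n.+1) != 0.
  move: (ab_reg (n + n)%N); rewrite -[a * b * _ * _]mulrA -exprD.
  by rewrite addnS addSn.
have ab_nE : a * b * q ^+ n.+2 * q ^+ n = a * b * q ^+ (n.+1 + n.+1).
  by rewrite -mulrA -exprD addSnnS.
rewrite ab_nE [q ^+ n.+1]exprS in coefS.
have D_neq0 : q ^+ n * (q - 1) * (1 - a * b * q ^+ (n.+1 + n.+1)) * q != 0.
  by rewrite !mulf_neq0.
apply: (mulIf D_neq0).
transitivity (L * (p`_n * ((q * q ^+ n - q ^+ n)
  * (1 - a * b * q ^+ (n.+1 + n.+1)) * q))); first by ring.
rewrite -coefS mulrA lead [q ^+ n.+1]exprS; field_nz.
Qed.

Lemma aq2_reg a i : (forall j, 1 - a * q * q ^+ j != 0) ->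
  1 - a * q ^+ 2 * q * q ^+ i != 0.
Proof.
move=> a_reg; move: (a_reg (2 + i)%N); rewrite [q ^+ (2 + i)]exprD.
by congr (_ != 0); ring.
Qed.

Lemma aq2b_reg a b i : (forall j, 1 - a * b * q ^+ 2 * q ^+ j != 0) ->
  1 - a * q ^+ 2 * b * q ^+ 2 * q ^+ i != 0.
Proof.
move=> ab_reg; move: (ab_reg (2 + i)%N); rewrite [q ^+ (2 + i)]exprD.
by congr (_ != 0); ring.
Qed.

End LittleQJacobi.

(** * Convergence of the scalar series *)

Section JacobiSeries.
Variables (R : realType) (q b : R).
Hypotheses (q_bounds : 0 < q < 1) (bq_lt1 : b * q < 1).

Let q_gt0 : 0 < q. Proof. by case/andP: q_bounds. Qed.
Let q_lt1 : q < 1. Proof. by case/andP: q_bounds. Qed.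

Definition qpoch_ratio x : R := qpoch q (b * q) x / qpoch q q x.

Lemma mul_qexp_lt1 c x : c < 1 -> c * q ^+ x < 1.
Proof.
move=> c_lt1; have qx_gt0 : 0 < q ^+ x by rewrite exprn_gt0.
have qx_le1 : q ^+ x <= 1 by rewrite exprn_ile1 // ltW.
have [c_ge0|c_lt0] := leP 0 c.
  by rewrite (le_lt_trans _ c_lt1) // ler_piMr.
by rewrite (lt_trans _ ltr01) // nmulr_rlt0.
Qed.

Lemma qpoch_ratioS x :
  qpoch_ratio x.+1 = qpoch_ratio x * ((1 - b * q * q ^+ x) / (1 - q * q ^+ x)).
Proof. by rewrite /qpoch_ratio !qpochS mulf_div. Qed.

Lemma qpoch_ratio_gt0 x : 0 < qpoch_ratio x.
Proof.
elim: x => [|x IHx]; first by rewrite /qpoch_ratio !qpoch0 divr1.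
by rewrite qpoch_ratioS mulr_gt0 // divr_gt0 // subr_gt0 ?mul_qexp_lt1.
Qed.

(** The factors of the ratio are at most [1 + K q^x], hence at most
    [exp (K q^x)], and the exponents have a convergent sum. *)
Lemma qpoch_ratio_le : exists M, forall x, qpoch_ratio x <= M.
Proof.
pose K : R := (1 + `|b|) / (1 - q).
have K_ge0 : 0 <= K by rewrite divr_ge0 // ?subr_ge0 ?ltW // ltr_wpDr.
exists (expR (K / (1 - q))) => x.
suff: qpoch_ratio x <= expR (K * ((1 - q ^+ x) / (1 - q))).
  move/le_trans; apply; rewrite ler_expR ler_wpM2l // ler_piMl //.
    by rewrite invr_ge0 subr_ge0 ltW.
  by rewrite gerBl exprn_ge0 // ltW.
elim: x => [|x IHx].
  by rewrite expr0 subrr mul0r mulr0 expR0 /qpoch_ratio !qpoch0 divr1.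
have -> : K * ((1 - q ^+ x.+1) / (1 - q))
        = K * ((1 - q ^+ x) / (1 - q)) + K * q ^+ x.
  have q1 : 1 - q != 0 by rewrite subr_eq0 gt_eqF.
  by rewrite exprS; field_nz.
rewrite expRD qpoch_ratioS; apply: ler_pM IHx _.
- exact: ltW (qpoch_ratio_gt0 x).
- by rewrite divr_ge0 // subr_ge0 ltW // mul_qexp_lt1.
apply: le_trans (expR_ge1Dx _).
have qx_ge0 : 0 <= q ^+ x by rewrite exprn_ge0 // ltW.
have qx_lt1 := mul_qexp_lt1 x q_lt1.
rewrite ler_pdivrMr ?subr_gt0 //.
have le1 : (1 + `|b|) * q ^+ x <= K * q ^+ x * (1 - q * q ^+ x).
  have -> : K * q ^+ x * (1 - q * q ^+ x)
          = (1 + `|b|) * q ^+ x * ((1 - q * q ^+ x) / (1 - q)).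
    by rewrite /K; ring.
  rewrite ler_peMr ?mulr_ge0 ?addr_ge0 // ler_pdivlMr ?subr_gt0 // mul1r.
  by rewrite lerB // ler_piMr ?exprn_ile1 // ltW.
have := ler_norm (- b); rewrite normrN => le_b.
have : - b * (q * q ^+ x) <= `|b| * q ^+ x.
  apply: (le_trans (ler_wpM2r _ le_b)); first by rewrite mulr_ge0 // ltW.
  by rewrite ler_wpM2l // ler_piMl // ltW.
have : q * q ^+ x <= q ^+ x by rewrite ler_piMl // ltW.
nra.
Qed.

Lemma jacobi_series_cvg c : 0 <= c < 1 ->
  cvgn (series (fun x => c ^+ x * qpoch_ratio x)).
Proof.
move=> /andP[c_ge0 c_lt1]; have [M leM] := qpoch_ratio_le.
apply: (@series_le_cvg _ _ (geometric M c)) => [x|x|x|].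
- by rewrite mulr_ge0 ?exprn_ge0 // ltW ?qpoch_ratio_gt0.
- rewrite /= mulr_ge0 ?exprn_ge0 // (le_trans _ (leM 0)) //.
  by rewrite ltW ?qpoch_ratio_gt0.
- by rewrite /= mulrC ler_wpM2r ?exprn_ge0.
- by apply: is_cvg_geometric_series; rewrite ger0_norm.
Qed.

Definition jacobi_sum c : R := limn (series (fun x => c ^+ x * qpoch_ratio x)).

(** The recursion of the terms makes the difference of the two sides telescope:
    between the partial sums it is the [N]-th term of the second series minus
    that of the first. *)
Lemma jacobi_sum_qshift c : 0 <= c < 1 ->
  (1 - c) * jacobi_sum c = (1 - b * c * q) * jacobi_sum (c * q).
Proof.
move=> c01; have /andP[c_ge0 c_lt1] := c01.
have cq01 : 0 <= c * q < 1.
  apply/andP; split; first by rewrite mulr_ge0 // ltW.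
  by rewrite (le_lt_trans _ c_lt1) // ler_piMr // ltW.
have partial N :
    (1 - c) * series (fun x => c ^+ x * qpoch_ratio x) N
    - (1 - b * c * q) * series (fun x => (c * q) ^+ x * qpoch_ratio x) N
  = (c * q) ^+ N * qpoch_ratio N - c ^+ N * qpoch_ratio N.
  elim: N => [|N IHN].
    by rewrite !seriesEnat /= !big_geq // !mulr0 !expr0 !subrr.
  move: IHN; rewrite !seriesEnat /= !big_nat_recr //= => IHN.
  rewrite !mulrDr opprD addrACA IHN qpoch_ratioS !exprMn ![_ ^+ N.+1]exprS.
  have q1 : 1 - q * q ^+ N != 0 by rewrite subr_eq0 gt_eqF ?mul_qexp_lt1.
  by field_nz.
pose D N := (c * q) ^+ N * qpoch_ratio N - c ^+ N * qpoch_ratio N.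
have D_0 : D @ \oo --> (0 : R).
  rewrite -[X in _ --> X](subr0 0).
  by apply: cvgB; apply: cvg_series_cvg_0; exact: jacobi_series_cvg.
have D_S : D @ \oo -->
    (1 - c) * jacobi_sum c - (1 - b * c * q) * jacobi_sum (c * q).
  rewrite /D -(funext partial).
  by apply: cvgB; apply: cvgMl_tmp; exact: jacobi_series_cvg.
by apply/eqP; rewrite -subr_eq0; apply/eqP; exact: (cvg_unique _ D_S D_0).
Qed.

End JacobiSeries.

(** The casts select the topology that a field with a norm gets from that norm;
    it is attached to the structure and not to the type [R[i]] itself. *)
Lemma cvg_real_complex (R : realType) (u : nat -> R) (l : R) :
  u @ \oo --> l ->
  (fun n => (u n)%:C%C : (R[i] : numClosedFieldType)) @ \oo
    --> (l%:C%C : (R[i] : numClosedFieldType)).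
Proof.
move=> /cvgrPdist_lt u_l; apply/cvgrPdist_lt => -[e e'].
rewrite ltcE /= => /andP[/eqP -> e_gt0].
apply: filterS (u_l _ e_gt0) => n lt_n.
by rewrite -rmorphB normc_def /= expr0n addr0 sqrtr_sqr ltcE /= eqxx.
Qed.

Lemma cvg_mx_entries (C : numClosedFieldType) m n
    (u : nat -> 'M[C]_(m.+1, n.+1)) (l : 'M[C]_(m.+1, n.+1)) :
  (forall i j, (fun k => u k i j) @ \oo --> l i j) -> u @ \oo --> l.
Proof.
move=> cvg_ij; apply/cvg_mx_entourageP => A entA.
have near_ij i j : \forall k \near \oo, (l i j, u k i j) \in A.
  have /cvg_entourageP/(_ _ entA) near_A := cvg_ij i j.
  have near_k : \forall k \near \oo, A (l i j, u k i j) by exact: near_A.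
  by apply: filterS near_k => k Ak; rewrite inE.
have : \forall k \near \oo, forall i j, (l i j, u k i j) \in A.
  apply: (@filter_forall _ _ (fun i k => forall j, (l i j, u k i j) \in A) _ _).
  move=> i; apply: (@filter_forall _ _ (fun j k => (l i j, u k i j) \in A) _ _).
  exact: near_ij.
exact.
Qed.

(** * Two-by-two matrices of polynomials *)

Lemma ord2P (P : 'I_2 -> Prop) : P 0 -> P 1 -> forall i, P i.
Proof.
move=> P0 P1 i; case: (unliftP 0 i) => [j ->|->] //.
by rewrite ord1 (_ : lift 0 0 = 1) //; apply: val_inj.
Qed.

Definition mx2 (T : Type) (m11 m12 m21 m22 : T) : 'M[T]_2 :=
  \matrix_(i, j) if i == 0 then (if j == 0 then m11 else m12)
                 else (if j == 0 then m21 else m22).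

Lemma mulmx2E (S : pzSemiRingType) m n
    (G : 'M[S]_(m, 2)) (H : 'M[S]_(2, n)) i j :
  (G *m H) i j = G i 0 * H 0 j + G i 1 * H 1 j.
Proof.
rewrite mxE big_ord_recl big_ord1 (_ : lift ord0 ord0 = 1) //.
exact: val_inj.
Qed.

Lemma eq_mx2 (T : Type) (G H : 'M[T]_2) :
  G 0 0 = H 0 0 -> G 0 1 = H 0 1 -> G 1 0 = H 1 0 -> G 1 1 = H 1 1 -> G = H.
Proof. by move=> *; apply/matrixP; apply: ord2P; apply: ord2P. Qed.

Section MatrixPolynomials.
Variables (C : numClosedFieldType) (l : {scalar {poly C}}).
Implicit Types (G H : 'M[{poly C}]_2) (c : 'M[C]_2).

(** Conjugating coefficients keeps the variable fixed, so this agrees with the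
    adjoint of the values at real points only. *)
Definition pmx_adjoint G : 'M[{poly C}]_2 := (map_mx (map_poly Num.conj) G)^T.
Definition pmx_form G H : 'M[C]_2 := map_mx l (G *m pmx_adjoint H).

Lemma map_mx_mulCl c G :
  map_mx l (map_mx polyC c *m G) = c *m map_mx l G.
Proof.
apply/matrixP => i j; rewrite mxE !mulmx2E !mxE !mul_polyC linearD !linearZ.
by [].
Qed.

Lemma map_mx_mulCr c G :
  map_mx l (G *m map_mx polyC c) = map_mx l G *m c.
Proof.
apply/matrixP => i j; rewrite mxE !mulmx2E !mxE ![_ * _%:P]mulrC !mul_polyC.
by rewrite linearD !linearZ /= ![_ * c _ _]mulrC.
Qed.

Lemma pmx_formBl G1 G2 H :
  pmx_form (G1 - G2) H = pmx_form G1 H - pmx_form G2 H.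
Proof. by rewrite /pmx_form mulmxBl map_mxB. Qed.

Lemma pmx_formMl c G H :
  pmx_form (map_mx polyC c *m G) H = c *m pmx_form G H.
Proof. by rewrite /pmx_form -mulmxA map_mx_mulCl. Qed.

Lemma pmx_formDr G H1 H2 :
  pmx_form G (H1 + H2) = pmx_form G H1 + pmx_form G H2.
Proof. by rewrite /pmx_form /pmx_adjoint map_mxD linearD /= mulmxDr map_mxD. Qed.

Lemma pmx_formMr c G H :
  pmx_form G (map_mx polyC c *m H) = pmx_form G H *m (c ^t* )%sesqui.
Proof.
rewrite -map_mx_mulCr -mulmxA; congr (map_mx l (G *m _)).
rewrite /pmx_adjoint map_mxM trmx_mul; congr (_ *m _).
by apply/matrixP => i j; rewrite !mxE [LHS]map_polyC.
Qed.

End MatrixPolynomials.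

Section PolyMatrixEntries.
Variable C : numClosedFieldType.
Implicit Types (P : {poly 'M[C]_2}) (G : 'M[{poly C}]_2).

Definition pmx_of P : 'M[{poly C}]_2 :=
  \matrix_(i, j) \poly_(k < size P) P`_k i j.

Lemma coef_pmx_of P i j k : (pmx_of P i j)`_k = P`_k i j.
Proof.
rewrite mxE coef_poly; case: ltnP => // le_k.
by rewrite nth_default // mxE.
Qed.

Lemma horner_pmx_of P z : P.[z%:M] = map_mx (horner_eval z) (pmx_of P).
Proof.
apply/matrixP => i j; rewrite !mxE horner_evalE horner_poly horner_coef summxE.
apply: eq_bigr => k _; have -> : (z%:M : 'M[C]_2) ^+ k = (z ^+ k)%:M.
  by rewrite -rmorphXn.
by rewrite [_ * _]mul_mx_scalar mxE mulrC.
Qed.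

End PolyMatrixEntries.

(** * The explicit polynomials are orthogonal to lower degrees *)

Section ExplicitPolynomials.
Variables (C : numClosedFieldType) (q a b v : C).
Hypotheses (q_neq0 : q != 0) (q_reg : forall i, 1 - q * q ^+ i != 0).
Hypotheses (a_reg : forall i, 1 - a * q * q ^+ i != 0)
  (ab_reg : forall i, 1 - a * b * q ^+ 2 * q ^+ i != 0).
Implicit Types (G H D : 'M[{poly C}]_2).

(** The polynomial matrix whose value at [q^x] is [A^x]. *)
Definition weight_root : 'M[{poly C}]_2 := mx2 'X (- v%:P * (1 - 'X)) 0 1.

(** The inner product, divided by the total mass of the scalar weight. *)
Definition weight_form G H :=
  pmx_form (jacobi_functional q a b) (G *m weight_root) (H *m weight_root).

Lemma weight_formBl G1 G2 H :
  weight_form (G1 - G2) H = weight_form G1 H - weight_form G2 H.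
Proof. by rewrite /weight_form mulmxBl pmx_formBl. Qed.

Lemma weight_formMl (c : 'M[C]_2) G H :
  weight_form (map_mx polyC c *m G) H = c *m weight_form G H.
Proof. by rewrite /weight_form -mulmxA pmx_formMl. Qed.

Lemma weight_formDr G H1 H2 :
  weight_form G (H1 + H2) = weight_form G H1 + weight_form G H2.
Proof. by rewrite /weight_form mulmxDl pmx_formDr. Qed.

Lemma weight_formMr (c : 'M[C]_2) G H :
  weight_form G (map_mx polyC c *m H) = weight_form G H *m (c ^t* )%sesqui.
Proof. by rewrite /weight_form -mulmxA pmx_formMr. Qed.

(** [N_n P_n] as a matrix of polynomials. *)
Definition mvop_numerator n : 'M[{poly C}]_2 :=
  let k11 := (kappa11 q a b n)%:P in
  let k12 := (kappa12 q a b v n)%:P in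
  let k21 := (kappa21 q a b v n)%:P in
  let k22 := (kappa22 q a b v n)%:P in
  let p := jacobi_poly q a b in
  let p2 := jacobi_poly q (a * q ^+ 2) b in
  mx2 (k11 * p2 n) (k12 * p n.+1 + k11 * (1 - 'X) * v%:P * p2 n)
      (k21 * p2 n.-1) (k22 * p n + k21 * (1 - 'X) * v%:P * p2 n.-1).

Lemma horner_mvop_numerator n z :
  explicit_mvop q a b v n z =
  invmx (matN q a b v n) *m map_mx (horner_eval z) (mvop_numerator n).
Proof.
congr (_ *m _); apply: eq_mx2; rewrite !mxE /= ?eqxx /= !horner_evalE !hornerE;
  by rewrite ?horner_jacobi_poly.
Qed.

Lemma mvop_numerator_root n :
  mvop_numerator n *m weight_root =
  mx2 ((kappa11 q a b n)%:P * ('X * jacobi_poly q (a * q ^+ 2) b n))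
      ((kappa12 q a b v n)%:P * jacobi_poly q a b n.+1)
      ((kappa21 q a b v n)%:P * ('X * jacobi_poly q (a * q ^+ 2) b n.-1))
      ((kappa22 q a b v n)%:P * jacobi_poly q a b n).
Proof. by apply: eq_mx2; rewrite mulmx2E !mxE /= ?eqxx /=; ring. Qed.

Lemma kappa2_0 : kappa21 q a b v 0 = 0 /\ kappa22 q a b v 0 = 1.
Proof.
rewrite /kappa21 /kappa22 /xi !expr0 subrr !(mul0r, mulr0, addr0) invr1.
by rewrite !qpoch0 divr1 !mulr1.
Qed.

Lemma kappa21S n :
  kappa21 q a b v n.+1 =
  kappa22 q a b v n.+1 * (a * v^* * q
    * ((1 - q ^+ n.+1) * (1 - b * q ^+ n.+1))
    / (q ^+ n * ((1 - a * q) * (1 - a * q ^+ 2)))).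
Proof.
have exp_q : q ^ ('C(n.+1, 2)%:Z - n.+1%:Z + 2) = q ^+ 'C(n.+1, 2) * q / q ^+ n.
  have -> : ('C(n.+1, 2)%:Z - n.+1%:Z + 2 = 'C(n, 2).+1%:Z)%R.
    by rewrite binS bin1 !PoszD; ring.
  rewrite -exprnP binS bin1 exprD exprS.
  have qn : q ^+ n != 0 by rewrite expf_neq0.
  by field_nz.
rewrite /kappa21 /kappa22 exp_q.
rewrite [in RHS]invfM; ring.
Qed.

(** This is the relation between squared norms that makes the choice of
    [kappa21] cancel the only surviving term in the second row. *)
Lemma jacobi_norm_ratio n :
  a * q * ((1 - q ^+ n.+1) * (1 - b * q ^+ n.+1))
    / (q ^+ n * ((1 - a * q) * (1 - a * q ^+ 2)))
    * (jacobi_moment q a b 2 * jacobi_norm q (a * q ^+ 2) b n)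
  = - jacobi_norm q a b n.+1.
Proof.
rewrite /jacobi_norm /jacobi_moment.
have -> : (n.+1 + n.+1 = 2 + (n + n))%N by rewrite addnS addSn.
rewrite !qpochD !qpochS !qpoch0 !mul1r !expr0 !mulr1 !expr1.
have -> : a * q ^+ 2 * b * q ^+ 2 = a * b * q ^+ 2 * q ^+ 2 by ring.
have ab2_reg i : 1 - a * b * q ^+ 2 * q ^+ 2 * q ^+ i != 0.
  by move: (ab_reg (2 + i)); rewrite [q ^+ (2 + i)]exprD mulrA.
have h1 := qpoch_neq0 n ab2_reg.
have h6 : qpoch q (a * b * q ^+ 2 * q ^+ 2 * q ^+ n) n != 0.
  by apply: qpoch_neq0 => i; rewrite -[_ * _ * q ^+ i]mulrA -exprD.
have h2 := ab_reg 0; have h3 := ab_reg 1.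
have h4 := a_reg 0; have h5 := a_reg 1.
rewrite expr0 mulr1 in h2; rewrite expr1 in h3.
rewrite expr0 mulr1 in h4; rewrite expr1 in h5.
have h5' : 1 - a * q ^+ 2 != 0 by rewrite expr2 mulrA.
have qn : q ^+ n != 0 by rewrite expf_neq0.
have -> : (- (a * q ^+ 2)) ^+ n = (- a) ^+ n * q ^+ n * q ^+ n.
  by rewrite -mulNr exprMn exprAC expr2 mulrA.
rewrite ['C(n.+2, 2)]binS bin1 [q ^+ (_ + n.+1)]exprD.
rewrite [q ^+ n.+1]exprS [(- a) ^+ n.+1]exprS.
field_nz.
Qed.

(** The conjugate of the second column of [D T] has this shape; the second
    claim isolates the coefficient that meets the norm of [p_n]. *)
Lemma size_combination n (d1 d2 : {poly C}) (c : C) :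
  (size d1 <= n)%N -> (size d2 <= n)%N ->
  (size (c%:P * (1 - 'X) * d1 + d2)%R <= n.+1)%N
  /\ (c%:P * (1 - 'X) * d1 + d2)`_n = - c * d1`_n.-1 *+ (0 < n)%N.
Proof.
move=> le1 le2; split.
  apply/leq_sizeP => j lt_nj.
  rewrite coefD -mulrA coefCM mulrBl coefB mul1r coefXM.
  case: j lt_nj => // j lt_nj /=; rewrite !nth_default ?subr0 ?mulr0 ?addr0 //.
  - by rewrite (leq_trans le2) // ltnW.
  - by rewrite (leq_trans le1).
  - by rewrite (leq_trans le1) // ltnW.
rewrite coefD -mulrA coefCM mulrBl coefB mul1r coefXM.
rewrite [d1`_n]nth_default // [d2`_n]nth_default // sub0r addr0.
case: n {le1 le2} => [|n] /=; first by rewrite oppr0 mulr0.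
by rewrite mulrN mulNr.
Qed.

(** In the first row, [p2_n] and [p_(n+1)] are tested against polynomials of
    degree less than [n] and less than [n + 1]. In the second row [p2_(n-1)]
    and [p_n] meet test polynomials of one degree more than orthogonality
    covers, and the two resulting norms cancel. *)
Lemma weight_form_numerator n D :
  (forall i j, size (D i j) <= n)%N ->
  weight_form (mvop_numerator n) D = 0.
Proof.
move=> le_D; pose E i j := map_poly Num.conj (D i j).
have le_E i j : (size (E i j) <= n)%N by rewrite size_map_poly.
have conj_root j : pmx_adjoint (D *m weight_root) 0 j = 'X * E j 0
    /\ pmx_adjoint (D *m weight_root) 1 j
       = (- v^* )%:P * (1 - 'X) * E j 0 + E j 1.
  have conjE i : pmx_adjoint (D *m weight_root) i j
      = map_poly Num.conj (D j 0 * weight_root 0 i + D j 1 * weight_root 1 i).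
    by rewrite -mulmx2E 2![LHS]mxE.
  rewrite !conjE !mxE /= !rmorphD !rmorphM /= !rmorphN !rmorphB /=.
  rewrite !rmorph0 !rmorph1 map_polyX map_polyC /=.
  by split; rewrite /E ?polyCN; ring.
have a2_reg i := aq2_reg i a_reg; have a2b_reg i := aq2b_reg i ab_reg.
apply/matrixP => i j; rewrite /weight_form mvop_numerator_root.
rewrite mxE mulmx2E [RHS]mxE; have [-> ->] := conj_root j.
have [le_c coef_c] := size_combination (- v^* ) (le_E j 0) (le_E j 1).
set c := _ + E j 1 in le_c coef_c *.
move: i; apply: ord2P; rewrite !mxE /=.
  set p2 := jacobi_poly _ _ _ n; set p := jacobi_poly _ _ _ n.+1.
  have -> : (kappa11 q a b n)%:P * ('X * p2) * ('X * E j 0)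
      + (kappa12 q a b v n)%:P * p * c
    = kappa11 q a b n *: ('X^2 * (E j 0 * p2)) + kappa12 q a b v n *: (c * p).
    by rewrite -!mul_polyC; ring.
  rewrite linearD !linearZ /= jacobi_functionalX2 //.
  rewrite !jacobi_functional_Mjacobi // ?(leq_trans (le_E _ _)) ?(leqW le_c) //.
  by rewrite !nth_default ?mul0r ?mulr0 ?addr0.
case: n => [|n] in le_D E le_E conj_root c le_c coef_c *.
  have E0 k : E j k = 0 by apply/eqP; rewrite -size_poly_leq0.
  by rewrite /c !E0 !(mulr0, addr0) linear0.
rewrite /=; set p2 := jacobi_poly _ _ _ n; set p := jacobi_poly _ _ _ n.+1.
have -> : (kappa21 q a b v n.+1)%:P * ('X * p2) * ('X * E j 0)
    + (kappa22 q a b v n.+1)%:P * p * c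
  = kappa21 q a b v n.+1 *: ('X^2 * (E j 0 * p2))
    + kappa22 q a b v n.+1 *: (c * p) by rewrite -!mul_polyC; ring.
rewrite linearD !linearZ /= jacobi_functionalX2 //.
rewrite !jacobi_functional_Mjacobi // coef_c /= mulr1n opprK.
rewrite kappa21S -[jacobi_norm _ a _ _]opprK -jacobi_norm_ratio; ring.
Qed.

End ExplicitPolynomials.

(** * Leading coefficient of the explicit polynomials *)

Section LeadingCoefficient.
Variables (C : numClosedFieldType) (q a b v : C).
Hypotheses (q_neq0 : q != 0) (q_reg : forall i, 1 - q * q ^+ i != 0).
Hypotheses (a_reg : forall i, 1 - a * q * q ^+ i != 0)
  (ab_reg : forall i, 1 - a * b * q ^+ 2 * q ^+ i != 0).

Let a2_reg i : 1 - a * q ^+ 2 * q * q ^+ i != 0.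
Proof. exact: aq2_reg. Qed.

Let a2b_reg i : 1 - a * q ^+ 2 * b * q ^+ 2 * q ^+ i != 0.
Proof. exact: aq2b_reg. Qed.

Lemma kappa11E n : kappa11 q a b n = jacobi_monic_factor q (a * q ^+ 2) b n.
Proof.
rewrite /kappa11 /jacobi_monic_factor; congr (_ * (qpoch q _ _ / qpoch q _ _)).
  by rewrite exprSr mulrA.
by rewrite addn3 [q ^+ n.+3]exprS [q ^+ n.+2]exprS; ring.
Qed.

Lemma kappa12E n : kappa12 q a b v n = v * jacobi_monic_factor q a b n.+1.
Proof. by rewrite /kappa12 /jacobi_monic_factor addn2; ring. Qed.

Lemma kappa22E n :
  kappa22 q a b v n = xi q a b v n * jacobi_monic_factor q a b n.
Proof. by rewrite /kappa22 /jacobi_monic_factor; ring. Qed.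

Let ab2n_neq0 n : 1 - a * b * q ^+ (2 * n + 2) != 0.
Proof.
by move: (ab_reg (2 * n)); rewrite -[a * b * _ * _]mulrA -exprD addnC.
Qed.

Lemma alphaE n :
  alpha q a b v n =
  v * (1 + q ^+ n * ((a * q - 1) / (1 - a * b * q ^+ (2 * n + 2)))).
Proof.
have := ab2n_neq0 n; rewrite /alpha [q ^+ n.+1]exprS => ab_n; field_nz.
Qed.

(** The upper right entry is [v] times the difference of monic polynomials of
    degree [n + 1], so [alpha] is a difference of subleading coefficients. *)
Lemma alpha_sublead n :
  v * (jacobi_monic_factor q a b n.+1 * ('X * jacobi_poly q a b n.+1)`_n.+1)
  + v - v * (jacobi_monic_factor q (a * q ^+ 2) b n
             * ('X * jacobi_poly q (a * q ^+ 2) b n)`_n)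
  = alpha q a b v n.
Proof.
rewrite !jacobi_poly_sublead // alphaE.
have q1 : q - 1 != 0.
  by rewrite -opprB oppr_eq0; move: (q_reg 0); rewrite expr0 mulr1.
have -> : a * b * q ^+ (n.+1 + n.+1) = a * b * q ^+ (2 * n + 2).
  by congr (_ * q ^+ _); rewrite addnS addSn mul2n -addnn addn2.
have -> : a * q ^+ 2 * b * q ^+ (n + n) = a * b * q ^+ (2 * n + 2).
  by rewrite mul2n -addnn [q ^+ (n + n + 2)]exprD; ring.
have := ab2n_neq0 n; set u := a * b * _ => u_neq0.
rewrite [q ^+ n.+1]exprS; field_nz.
Qed.

(** With [kappa21S], this turns the contribution of [kappa21] to the lower
    right leading coefficient into the summand in the definition of [xi]. *)
Lemma lead_ratio n :
  a * q * ((1 - q ^+ n.+1) * (1 - b * q ^+ n.+1))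
    / (q ^+ n * ((1 - a * q) * (1 - a * q ^+ 2)))
    * (jacobi_monic_factor q a b n.+1 / jacobi_monic_factor q (a * q ^+ 2) b n)
  = - (a * q * ((1 - q ^+ n.+1) * (1 - b * q ^+ n.+1)
     / ((1 - a * b * q ^+ n.+2) * (1 - a * q ^+ n.+2)))).
Proof.
have an_neq0 : 1 - a * q ^+ n.+2 != 0.
  by move: (a_reg n.+1); rewrite -mulrA -exprS.
have abn_neq0 : 1 - a * b * q ^+ n.+2 != 0.
  by move: (ab_reg n); rewrite -[a * b * _ * _]mulrA -exprD.
have q1 := a_reg 0; have q2 := a_reg 1; rewrite expr0 mulr1 in q1.
rewrite expr1 -mulrA -expr2 in q2.
have qa : qpoch q (a * q) n.+1
    = (1 - a * q) * (1 - a * q ^+ 2) * qpoch q (a * q ^+ 2 * q) n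
      / (1 - a * q ^+ n.+2).
  apply: (mulIf an_neq0); rewrite mulfVK // [in LHS]exprS mulrA -qpochS.
  by rewrite !qpochSl -[a * q * q]mulrA -expr2 [LHS]mulrA.
have qab : qpoch q (a * b * q ^+ n.+2) n.+1
    = (1 - a * b * q ^+ n.+2) * qpoch q (a * q ^+ 2 * b * q ^+ n.+1) n.
  rewrite qpochSl; congr (_ * qpoch q _ _).
  by rewrite [q ^+ n.+2]exprS; ring.
rewrite /jacobi_monic_factor qa qab binS bin1.
have h1 := qpoch_neq0 n a2_reg.
have h2 := qpoch_abSn_neq0 n a2b_reg.
have h3 : q ^+ n != 0 by rewrite expf_neq0.
have h4 : q ^+ 'C(n, 2) != 0 by rewrite expf_neq0.
have h5 : (-1) ^+ n != 0 :> C by rewrite signr_eq0.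
rewrite [q ^+ (_ + n)]exprD [(-1) ^+ n.+1]exprS; field_nz.
Qed.

(** The terms of degree [n + 1] in the upper right entry cancel since [kappa11]
    and [kappa12 / v] normalise their polynomials to be monic. In the lower
    right entry both summands reach degree [n]; without their common factor
    [xi] their leading coefficients add up to [xi^-1]. *)
Lemma coef_mvop_numerator n k :
  1 + a * q * `|v| ^+ 2 * ((1 - q ^+ n) * (1 - b * q ^+ n)
     / ((1 - a * b * q ^+ n.+1) * (1 - a * q ^+ n.+1))) != 0 ->
  (n <= k)%N ->
  map_mx (coefp k) (mvop_numerator q a b v n) =
  if k == n then matN q a b v n else 0.
Proof.
move=> xi_reg le_nk.
have size_p a' m : (size (jacobi_poly q a' b m) <= m.+1)%N by exact: size_poly.
have big m a' j : (m < j)%N -> (jacobi_poly q a' b m)`_j = 0.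
  by move=> lt_mj; rewrite nth_default // (leq_trans (size_p _ _)).
have entry01 : kappa12 q a b v n * (jacobi_poly q a b n.+1)`_k
    + kappa11 q a b n * v * ((jacobi_poly q (a * q ^+ 2) b n)`_k
       - ('X * jacobi_poly q (a * q ^+ 2) b n)`_k)
    = if k == n then alpha q a b v n else 0.
  rewrite kappa11E kappa12E; have [->|ne_kn] := eqVneq k n.
    rewrite -alpha_sublead [('X * jacobi_poly q a b n.+1)`_n.+1]coefXM /=.
    have := jacobi_poly_lead q_neq0 q_reg n a2_reg a2b_reg.
    set L := jacobi_monic_factor q (a * q ^+ 2) b n.
    set p := jacobi_poly _ _ _ _.
    move=> lead; have lead_v : v = v * (L * p`_n) by rewrite lead mulr1.
    by rewrite [X in _ = _ + X - _]lead_v; ring.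
  have lt_nk : (n < k)%N by rewrite ltn_neqAle eq_sym ne_kn.
  case: k lt_nk {le_nk ne_kn} => // k; rewrite ltnS => le_nk.
  rewrite coefXM /= [(jacobi_poly q (a * q ^+ 2) b n)`_k.+1]big ?ltnS //.
  have [->|ne_kn] := eqVneq k n.
    have := jacobi_poly_lead q_neq0 q_reg n a2_reg a2b_reg.
    have := jacobi_poly_lead q_neq0 q_reg n.+1 a_reg ab_reg.
    set L := jacobi_monic_factor _ _ _ _; set L' := jacobi_monic_factor _ _ _ _.
    move=> lead lead'; rewrite -mulrA lead sub0r mulrN mulrAC lead'; ring.
  have lt_nk : (n < k)%N by rewrite ltn_neqAle eq_sym ne_kn.
  by rewrite !big ?ltnS // subrr !mulr0 addr0.
have entry11 : kappa22 q a b v n * (jacobi_poly q a b n)`_k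
    + kappa21 q a b v n * v * ((jacobi_poly q (a * q ^+ 2) b n.-1)`_k
       - ('X * jacobi_poly q (a * q ^+ 2) b n.-1)`_k)
    = (k == n)%:R.
  case: n le_nk xi_reg {entry01} => [|n] le_nk xi_reg.
    have [-> ->] := kappa2_0 q a b v.
    rewrite !mul0r addr0 mul1r; case: k le_nk => [_|k _]; last by rewrite big.
    have := jacobi_poly_lead q_neq0 q_reg 0 a_reg ab_reg.
    by rewrite /jacobi_monic_factor !qpoch0 divr1 !mulr1 mul1r.
  case: k le_nk => // k; rewrite ltnS => le_nk /=.
  rewrite coefXM /= [(jacobi_poly q (a * q ^+ 2) b n)`_k.+1]big ?ltnS //.
  have [->|ne_kn] := eqVneq k n; last first.
    have lt_nk : (n < k)%N by rewrite ltn_neqAle eq_sym ne_kn.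
    by rewrite !big ?ltnS // subrr !mulr0 addr0 eqSS (negbTE ne_kn).
  have lead' := jacobi_poly_lead q_neq0 q_reg n a2_reg a2b_reg.
  have lead := jacobi_poly_lead q_neq0 q_reg n.+1 a_reg ab_reg.
  have ratio := lead_ratio n.
  rewrite kappa21S // kappa22E eqxx.
  set L := jacobi_monic_factor q a b n.+1 in lead ratio *.
  set L' := jacobi_monic_factor _ _ _ _ in lead' ratio.
  have L'_neq0 : L' != 0.
    by apply/eqP => L'0; move/eqP: lead'; rewrite L'0 mul0r eq_sym oner_eq0.
  have -> : (jacobi_poly q (a * q ^+ 2) b n)`_n = L'^-1.
    by apply: (mulfI L'_neq0); rewrite lead' divff.
  rewrite -mulrA lead mulr1.
  transitivity (xi q a b v n.+1 * (1 - v * v^* *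
    (a * q * ((1 - q ^+ n.+1) * (1 - b * q ^+ n.+1))
    / (q ^+ n * ((1 - a * q) * (1 - a * q ^+ 2))) * (L / L')))); first by ring.
  rewrite ratio mulrN opprK -normCK /xi.
  rewrite -[RHS](mulVf xi_reg); congr (_ * _); ring.
have entry10 : kappa21 q a b v n * (jacobi_poly q (a * q ^+ 2) b n.-1)`_k = 0.
  case: n le_nk {xi_reg entry01 entry11} => [|n] le_nk.
    by have [-> _] := kappa2_0 q a b v; rewrite mul0r.
  by rewrite big ?mulr0.
have entry00 :
    kappa11 q a b n * (jacobi_poly q (a * q ^+ 2) b n)`_k = (k == n)%:R.
  rewrite kappa11E; have [->|ne_kn] := eqVneq k n.
    exact: jacobi_poly_lead.
  by rewrite big ?mulr0 // ltn_neqAle eq_sym ne_kn.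
have split_entry (c w : C) (f g : {poly C}) :
    coefp k (c%:P * f + w%:P * (1 - 'X) * v%:P * g)
    = c * f`_k + w * v * (g`_k - ('X * g)`_k).
  rewrite /coefp /= coefD coefCM; congr (_ + _).
  have -> : w%:P * (1 - 'X) * v%:P * g = (w * v)%:P * (g - 'X * g).
    by rewrite polyCM; ring.
  by rewrite coefCM coefB.
apply: eq_mx2; rewrite !mxE /= ?eqxx /=.
- by rewrite coefCM entry00; case: eqP; rewrite !mxE.
- by rewrite -[LHS]/(coefp k _) split_entry entry01; case: eqP; rewrite !mxE.
- by rewrite coefCM entry10; case: eqP; rewrite !mxE.
- by rewrite -[LHS]/(coefp k _) split_entry entry11; case: eqP; rewrite !mxE.
Qed.

End LeadingCoefficient.

(** * The inner product as a series, and its definiteness *)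

(** The order of [C] is partial, so the partial sums are compared with a single
    term [u x] and not through a limit of inequalities: from [x] on they are at
    least [u x], whereas they tend to [0]. *)
Lemma nonneg_series_cvg0 (C : numClosedFieldType) (u : nat -> C) :
  (forall x, 0 <= u x) -> series u @ \oo --> (0 : C) -> forall x, u x = 0.
Proof.
move=> u_ge0 /cvgrPdist_lt u_0 x; apply/eqP/negPn/negP => ux_neq0.
have ux_gt0 : 0 < u x by rewrite lt_def ux_neq0 u_ge0.
have [N _ leN] := u_0 _ ux_gt0.
have := leN (N + x.+1)%N (leq_addr _ _); rewrite /= sub0r normrN.
rewrite ger0_norm ?sumr_ge0 // seriesEnat /= ?sumr_ge0 //.
rewrite big_mkord ?sumr_ge0 //.
have lt_x : (x < N + x.+1)%N by rewrite addnS ltnS leq_addl.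
rewrite (bigD1 (Ordinal lt_x)) //= gtrDl => /lt_geF/negP; apply.
by rewrite sumr_ge0.
Qed.

Lemma series_horner_cvg (C : numClosedFieldType) (mass z m : nat -> C) (mu : C)
    (f : {poly C}) :
  (forall j, series (fun x => mass x * z x ^+ j) @ \oo --> mu * m j) ->
  series (fun x => mass x * f.[z x]) @ \oo --> mu * moment_functional m f.
Proof.
move=> mass_cvg.
have partial d : (fun N => \sum_(j < d) f`_j
      * series (fun x => mass x * z x ^+ j) N) @ \oo
    --> \sum_(j < d) f`_j * (mu * m j).
  elim: d => [|d IHd].
    under eq_fun do rewrite big_ord0.
    by rewrite big_ord0; exact: cvg_cst.
  under eq_fun do rewrite big_ord_recr.
  by rewrite big_ord_recr; apply: cvgD => //; apply: cvgMl_tmp.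
have -> : mu * moment_functional m f = \sum_(j < size f) f`_j * (mu * m j).
  by rewrite mulr_sumr; apply: eq_bigr => j _; rewrite mulrCA.
have -> : series (fun x => mass x * f.[z x]) = fun N =>
    \sum_(j < size f) f`_j * series (fun x => mass x * z x ^+ j) N.
  apply/funext => N; under [RHS]eq_bigr do rewrite seriesEnat /= mulr_sumr.
  rewrite exchange_big seriesEnat /=; apply: eq_bigr => x _.
  by rewrite horner_coef mulr_sumr; apply: eq_bigr => j _; rewrite mulrCA.
exact: partial.
Qed.

Section MatrixWeight.
Variables (C : numClosedFieldType) (q a b v mu : C).
Hypotheses (q_gt0 : 0 < q) (q_lt1 : q < 1).
Let mass x : C := (a * q) ^+ x * (qpoch q (b * q) x / qpoch q q x).
Hypothesis mass_gt0 : forall x, 0 < mass x.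
(* [mu] is the total mass of the scalar weight. *)
Hypothesis mass_cvg : forall f : {poly C},
  series (fun x => mass x * f.[q ^+ x]) @ \oo
    --> mu * jacobi_functional q a b f.
Implicit Types (P Q : {poly 'M[C]_2}) (G H D : 'M[{poly C}]_2).

Let qx_conj x : (q ^+ x)^* = q ^+ x.
Proof. by apply: CrealP; rewrite realX // realE ltW. Qed.

Lemma qexp_roots (f : {poly C}) : (forall x, f.[q ^+ x] = 0) -> f = 0.
Proof.
move=> f_0; apply/eqP/negPn/negP => f_neq0.
have q_inj : injective (GRing.exp q).
  by apply: ieexprIn => //; rewrite lt_eqF.
pose rs := [seq q ^+ x | x <- iota 0 (size f)].
have rs_roots : all (root f) rs.
  by apply/allP => _ /mapP[x _ ->]; rewrite rootE f_0.
have rs_uniq : uniq rs by rewrite map_inj_uniq ?iota_uniq.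
have := max_poly_roots f_neq0 rs_roots rs_uniq.
by rewrite size_map size_iota ltnn.
Qed.

(** A zero total mass would make every mass zero. *)
Lemma mass_sum_neq0 : mu != 0.
Proof.
apply/eqP => mu0; have := @mass_cvg 1; rewrite mu0 mul0r.
move=> /nonneg_series_cvg0 mass0.
have := @mass_gt0 0; have := mass0 _ 0; rewrite hornerC mulr1 => -> //.
  by rewrite ltxx.
by move=> x; rewrite hornerC mulr1 ltW.
Qed.

Lemma horner_pmx_adjoint G x :
  map_mx (horner_eval (q ^+ x)) (pmx_adjoint G)
  = ((map_mx (horner_eval (q ^+ x)) G) ^t* )%sesqui.
Proof.
apply/matrixP => i j; rewrite !mxE !horner_evalE -[in LHS](qx_conj x).
exact: horner_map.
Qed.

Lemma matA_exp x :
  matA q v ^+ x = map_mx (horner_eval (q ^+ x)) (weight_root v).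
Proof.
elim: x => [|x IHx].
  apply: eq_mx2; rewrite !mxE /= ?eqxx /= horner_evalE;
    by rewrite !hornerE ?subrr ?mulr0.
rewrite exprS IHx [_ * _]/(_ *m _).
apply: eq_mx2; rewrite mulmx2E !mxE /= ?eqxx /= !horner_evalE;
  by rewrite ?(hornerM, hornerD, hornerN, hornerX, hornerC) ?exprS; ring.
Qed.

Lemma adjoint_exp (M : 'M[C]_2) x :
  (M ^t* )%sesqui ^+ x = ((M ^+ x) ^t* )%sesqui.
Proof.
elim: x => [|x IHx].
  by rewrite !expr0 trmx1 map_mx1.
by rewrite exprS IHx exprSr [in RHS]trmx_mul map_mxM.
Qed.

Lemma inner_product_form P Q :
  inner_product q (weight q a b v) P Q
  = mu *: weight_form q a b v (pmx_of P) (pmx_of Q).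
Proof.
apply: cvg_lim; first exact: norm_hausdorff.
apply: cvg_mx_entries => i j; rewrite mxE /weight_form /pmx_form.
rewrite [map_mx _ _ _ _]mxE; set f : {poly C} := (_ *m _) i j.
rewrite (_ : (fun k => _) = series (fun x => mass x * f.[q ^+ x])) //.
apply/funext => k; rewrite !seriesEnat /= summxE; apply: eq_bigr => x _.
rewrite /weight matA_exp adjoint_exp matA_exp !horner_pmx_of.
set e := map_mx (horner_eval (q ^+ x)).
have -> : f.[q ^+ x] = e (pmx_of P *m weight_root v
    *m pmx_adjoint (pmx_of Q *m weight_root v)) i j by rewrite mxE.
rewrite /e !map_mxM horner_pmx_adjoint map_mxM /= trmx_mul map_mxM.
rewrite -/e -scalemxAr -scalemxAl scalerA mxE !mulmxA; congr (_ * _).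
by rewrite /mass exprMn; ring.
Qed.

Lemma horner_sqr_norm G i x : ((G *m pmx_adjoint G) i i).[q ^+ x]
    = `|(G i 0).[q ^+ x]| ^+ 2 + `|(G i 1).[q ^+ x]| ^+ 2.
Proof.
have := congr1 (fun M : 'M[C]_2 => M i i)
  (map_mxM (horner_eval (q ^+ x)) G (pmx_adjoint G)).
rewrite horner_pmx_adjoint /= [RHS]mulmx2E [LHS]mxE horner_evalE => ->.
by rewrite !mxE !normCK.
Qed.

(** The diagonal of the form is a series of nonnegative terms, so [D T]
    vanishes at every [q^x] and hence identically; [T] is triangular with
    diagonal [(z, 1)], so [D = 0]. *)
Lemma weight_form_definite D : weight_form q a b v D D = 0 -> D = 0.
Proof.
move=> form0; set G := D *m weight_root v.
have G0 i k : G i k = 0.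
  have := @mass_cvg ((G *m pmx_adjoint G) i i).
  have -> : jacobi_functional q a b ((G *m pmx_adjoint G) i i) = 0.
    by have := congr1 (fun M : 'M[C]_2 => M i i) form0; rewrite !mxE.
  rewrite mulr0 => /nonneg_series_cvg0 term0.
  have term_ge0 x : 0 <= mass x * ((G *m pmx_adjoint G) i i).[q ^+ x].
    by rewrite horner_sqr_norm mulr_ge0 ?addr_ge0 ?exprn_ge0 // ltW.
  apply: qexp_roots => x; have /eqP := term0 term_ge0 x.
  rewrite horner_sqr_norm mulf_eq0 gt_eqF //= paddr_eq0 ?exprn_ge0 //.
  rewrite !expf_eq0 /= !normr_eq0 => /andP[/eqP Gi0 /eqP Gi1].
  by move: k; apply: ord2P.
have D0 i : D i 0 = 0.
  apply/eqP; have := G0 i 0; rewrite mulmx2E !mxE /= mulr0 addr0 => /eqP.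
  by rewrite mulf_eq0 polyX_eq0 orbF.
apply/matrixP => i j; rewrite mxE; move: j; apply: ord2P => //.
by have := G0 i 1; rewrite mulmx2E !mxE /= D0 mul0r add0r mulr1.
Qed.

End MatrixWeight.

(** * Uniqueness of the monic orthogonal polynomials *)

Section Uniqueness.
Variables (C : numClosedFieldType) (q a b v : C).
Implicit Types (P : nat -> {poly 'M[C]_2}) (D G : 'M[{poly C}]_2).

Lemma pmx_sizeP G k :
  (forall m, (k <= m)%N -> map_mx (coefp m) G = 0) <->
  (forall i j, size (G i j) <= k)%N.
Proof.
split=> [G0 i j|le_G m le_km].
  apply/leq_sizeP => m le_km.
  by have := congr1 (fun M : 'M[C]_2 => M i j) (G0 m le_km); rewrite !mxE.
by apply/matrixP => i j; rewrite !mxE /coefp nth_default // (leq_trans _ le_km).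
Qed.

Lemma map_coefp_pmx_of (p : {poly 'M[C]_2}) m :
  map_mx (coefp m) (pmx_of p) = p`_m.
Proof. by apply/matrixP => i j; rewrite mxE -coef_pmx_of. Qed.

(** Subtracting from [D] its top coefficient times [P_k] lowers the degree and
    does not change the form. *)
Lemma weight_form_low_degree P n :
  (forall m, size (P m) = m.+1 /\ P m \is monic) ->
  (forall m, (m < n)%N ->
     weight_form q a b v (pmx_of (P n)) (pmx_of (P m)) = 0) ->
  forall k D, (k <= n)%N -> (forall i j, size (D i j) <= k)%N ->
  weight_form q a b v (pmx_of (P n)) D = 0.
Proof.
move=> P_monic P_orth; elim=> [|k IHk] D le_kn le_D.
  have -> : D = map_mx polyC 0 *m D.
    apply/matrixP => i j; rewrite mulmx2E !mxE !mul0r addr0.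
    by apply/eqP; rewrite -size_poly_leq0.
  by rewrite weight_formMr trmx0 map_mx0 mulmx0.
pose c := map_mx (coefp k) D; have [sz_Pk /eqP lead_Pk] := P_monic k.
pose D' := D - map_mx polyC c *m pmx_of (P k).
have -> : D = map_mx polyC c *m pmx_of (P k) + D' by rewrite addrC subrK.
rewrite weight_formDr weight_formMr P_orth // mul0mx add0r.
apply: IHk; first exact: ltnW.
apply/pmx_sizeP => m; rewrite map_mxB map_mx_mulCl map_coefp_pmx_of.
rewrite leq_eqVlt => /predU1P[<-|lt_km].
  have -> : (P k)`_k = 1 by rewrite -lead_Pk lead_coefE sz_Pk.
  by rewrite mulmx1 subrr.
rewrite [(P k)`_m]nth_default ?sz_Pk // mulmx0 subr0.
by move/pmx_sizeP: le_D => ->.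
Qed.

Hypotheses (q_neq0 : q != 0) (q_reg : forall i, 1 - q * q ^+ i != 0).
Hypotheses (a_reg : forall i, 1 - a * q * q ^+ i != 0)
  (ab_reg : forall i, 1 - a * b * q ^+ 2 * q ^+ i != 0).
Hypothesis xi_reg : forall n,
  1 + a * q * `|v| ^+ 2 * ((1 - q ^+ n) * (1 - b * q ^+ n)
     / ((1 - a * b * q ^+ n.+1) * (1 - a * q ^+ n.+1))) != 0.
Hypothesis definite : forall D, weight_form q a b v D D = 0 -> D = 0.

Lemma mulVmx_matN n : invmx (matN q a b v n) *m matN q a b v n = 1%:M.
Proof.
have inv_r : matN q a b v n *m mx22 1 (- alpha q a b v n) 0 1 = 1%:M.
  by apply: eq_mx2; rewrite mulmx2E !mxE /= ?eqxx /= ?mulr1n ?mulr0n; ring.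
by rewrite mulVmx //; case: (mulmx1_unit inv_r).
Qed.

(** The difference [D] of the two candidates has degree less than [n], so both
    are orthogonal to it and it is orthogonal to itself. *)
Lemma monic_orthogonal_explicit P :
  (forall m, size (P m) = m.+1 /\ P m \is monic) ->
  (forall m n, m != n ->
     weight_form q a b v (pmx_of (P m)) (pmx_of (P n)) = 0) ->
  forall n z, (P n).[z%:M] = explicit_mvop q a b v n z.
Proof.
move=> P_monic P_orth n z.
pose Q := map_mx polyC (invmx (matN q a b v n)) *m mvop_numerator q a b v n.
pose D := pmx_of (P n) - Q; have [sz_Pn /eqP lead_Pn] := P_monic n.
have le_D i j : (size (D i j) <= n)%N.
  move: i j; apply/pmx_sizeP => m le_nm.
  rewrite map_mxB map_mx_mulCl map_coefp_pmx_of coef_mvop_numerator //.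
  have [->|ne_mn] := eqVneq m n.
    have -> : (P n)`_n = 1 by rewrite -lead_Pn lead_coefE sz_Pn.
    by rewrite mulVmx_matN subrr.
  by rewrite mulmx0 subr0 nth_default // sz_Pn ltn_neqAle eq_sym ne_mn.
have D0 : D = 0.
  apply: definite; rewrite {1}/D weight_formBl weight_formMl.
  rewrite (@weight_form_low_degree P n P_monic _ n D) //.
    by rewrite weight_form_numerator // mulmx0 subrr.
  by move=> m lt_mn; rewrite P_orth // gtn_eqF.
have defP : pmx_of (P n) = Q by apply/eqP; rewrite -subr_eq0 -/D D0.
rewrite horner_pmx_of defP horner_mvop_numerator map_mxM; congr (_ *m _).
by rewrite -map_mx_comp; apply: map_mx_id => c; exact: hornerC.
Qed.

End Uniqueness.

Local Open Scope complex_scope.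

(** * Real parameters *)

Section RealParameters.
Variables (R : realType) (q a b : R).
Hypotheses (q_bounds : 0 < q < 1) (a_bounds : 0 < a < q^-1)
  (b_bound : b < q^-1).

Let q_gt0 : 0 < q. Proof. by case/andP: q_bounds. Qed.
Let q_lt1 : q < 1. Proof. by case/andP: q_bounds. Qed.
Let a_gt0 : 0 < a. Proof. by case/andP: a_bounds. Qed.
Let aq_lt1 : a * q < 1.
Proof. by case/andP: a_bounds => _; rewrite -(ltr_pM2r q_gt0) mulVf ?gt_eqF. Qed.
Let bq_lt1 : b * q < 1.
Proof. by move: b_bound; rewrite -(ltr_pM2r q_gt0) mulVf ?gt_eqF. Qed.

Lemma abq2_lt1 : a * b * q ^+ 2 < 1.
Proof.
have -> : a * b * q ^+ 2 = (a * q) * (b * q) by ring.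
have aq_gt0 : 0 < a * q by rewrite mulr_gt0.
have [bq_ge0|bq_lt0] := leP 0 (b * q).
  by rewrite (le_lt_trans _ bq_lt1) // ler_piMl // ltW.
by rewrite (lt_trans _ ltr01) // pmulr_rlt0.
Qed.

Lemma subr_qexp_neq0 c x : c < 1 -> 1 - c * q ^+ x != 0.
Proof. by move=> c_lt1; rewrite gt_eqF // subr_gt0 mul_qexp_lt1. Qed.

(** Iterating [jacobi_sum_qshift] from [c = a q]. *)
Lemma jacobi_sum_moment j :
  jacobi_sum q b (a * q * q ^+ j) =
  jacobi_sum q b (a * q) * jacobi_moment q a b j.
Proof.
elim: j => [|j IHj]; first by rewrite expr0 /jacobi_moment !qpoch0 divr1 !mulr1.
have h1 := subr_qexp_neq0 j abq2_lt1.
have h2 := qpoch_neq0 j (fun i => subr_qexp_neq0 i abq2_lt1).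
have /(jacobi_sum_qshift q_bounds bq_lt1) : 0 <= a * q * q ^+ j < 1.
  by rewrite (mul_qexp_lt1 q_bounds) // !mulr_ge0 ?exprn_ge0 ?ltW.
have -> : b * (a * q * q ^+ j) * q = a * b * q ^+ 2 * q ^+ j by ring.
rewrite IHj -[a * q * q ^+ j * q]mulrA -exprSr => shift.
apply: (mulfI h1); rewrite -shift /jacobi_moment !qpochS; field_nz.
Qed.

Lemma real_complex_qpoch c n : qpoch q%:C c%:C n = (qpoch q c n)%:C.
Proof.
rewrite /qpoch rmorph_prod; apply: eq_bigr => i _.
by rewrite rmorphB rmorph1 rmorphM rmorphXn.
Qed.

Let mass x : R[i] :=
  (a%:C * q%:C) ^+ x * (qpoch q%:C (b%:C * q%:C) x / qpoch q%:C q%:C x).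

Lemma massE x : mass x = ((a * q) ^+ x * qpoch_ratio q b x)%:C.
Proof.
by rewrite /mass -!rmorphM !real_complex_qpoch -rmorphXn -fmorph_div -rmorphM.
Qed.

Lemma real_mass_gt0 x : 0 < mass x.
Proof.
rewrite massE ltcR; apply: mulr_gt0; last exact: qpoch_ratio_gt0.
by rewrite exprn_gt0 ?mulr_gt0.
Qed.

Lemma real_mass_cvg (f : {poly R[i]}) :
  series (fun x => mass x * f.[q%:C ^+ x] : (R[i] : numClosedFieldType)) @ \oo
    --> ((jacobi_sum q b (a * q))%:C * jacobi_functional q%:C a%:C b%:C f
          : (R[i] : numClosedFieldType)).
Proof.
apply: series_horner_cvg => j.
pose c := a * q * q ^+ j.
have c_bounds : 0 <= c < 1.
  by rewrite (mul_qexp_lt1 q_bounds) // !mulr_ge0 ?exprn_ge0 ?ltW.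
have -> : (jacobi_sum q b (a * q))%:C * jacobi_moment q%:C a%:C b%:C j
    = (jacobi_sum q b c)%:C.
  rewrite jacobi_sum_moment rmorphM; congr (_ * _).
  rewrite /jacobi_moment fmorph_div /= -!real_complex_qpoch.
  by rewrite !(rmorphXn, rmorphM).
rewrite (_ : series _ = fun n =>
    (series (fun x => c ^+ x * qpoch_ratio q b x) n)%:C); last first.
  apply/funext => n; rewrite !seriesEnat /= rmorph_sum.
  apply: eq_bigr => x _; rewrite massE -!rmorphXn -rmorphM /c; congr (_ %:C).
  by rewrite [in RHS]exprMn -!exprM [(j * x)%N]mulnC; ring.
by apply: cvg_real_complex; exact: jacobi_series_cvg.
Qed.

Lemma real_xi_reg (v : R[i]) n :
  1 + a%:C * q%:C * `|v| ^+ 2 * ((1 - q%:C ^+ n) * (1 - b%:C * q%:C ^+ n)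
     / ((1 - a%:C * b%:C * q%:C ^+ n.+1) * (1 - a%:C * q%:C ^+ n.+1))) != 0.
Proof.
(* For [n = 0] the sign of [1 - b] and of [1 - a b q] is unknown, but the factor
   [1 - q^0] is zero. *)
case: n => [|n]; first by rewrite expr0 subrr !mul0r mulr0 addr0 oner_neq0.
rewrite gt_eqF // ltr_pwDl // mulr_ge0 //.
  by rewrite mulr_ge0 ?exprn_ge0 // mulr_ge0 // lecR ltW.
rewrite -!rmorphXn -!rmorphM -(rmorph1 (real_complex R)) -!rmorphB -!rmorphM.
rewrite -fmorph_div lecR divr_ge0 // mulr_ge0 // subr_ge0.
- by rewrite exprn_ile1 // ltW.
- by rewrite exprS mulrA ltW // (mul_qexp_lt1 q_bounds).
- rewrite [q ^+ n.+2](exprD _ 2) mulrA ltW // (mul_qexp_lt1 q_bounds) //.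
  exact: abq2_lt1.
- by rewrite exprS mulrA ltW // (mul_qexp_lt1 q_bounds).
Qed.

End RealParameters.

Theorem theorem5p5 (R : realType) (q a b : R) (v : R[i])
    (P : nat -> {poly 'M[R[i]]_2}) :
  0 < q < 1 -> 0 < a < q^-1 -> b < q^-1 ->
  monic_orthogonal q%:C (weight q%:C a%:C b%:C v) P ->
  forall n : nat,
    alpha q%:C a%:C b%:C v n =
      v * (1 + q%:C ^+ n * ((a%:C * q%:C - 1)
             / (1 - a%:C * b%:C * q%:C ^+ (2 * n + 2)))) /\
    forall z : R[i], (P n).[z%:M] = explicit_mvop q%:C a%:C b%:C v n z.
Proof.
move=> q_bounds a_bounds b_bound [P_monic P_orth] n.
have [q_gt0 q_lt1] := andP q_bounds; have [a_gt0 a_lt] := andP a_bounds.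
have aq_lt1 : a * q < 1 by move: a_lt; rewrite -(ltr_pM2r q_gt0) mulVf ?gt_eqF.
have reg c i : c < 1 -> 1 - c%:C * q%:C ^+ i != 0 :> R[i].
  move=> c_lt1; rewrite -rmorphXn -rmorphM -(rmorph1 (real_complex R)) -rmorphB.
  by rewrite fmorph_eq0 (subr_qexp_neq0 q_bounds).
have q_reg i : 1 - q%:C * q%:C ^+ i != 0 :> R[i] by exact: reg.
have a_reg i : 1 - a%:C * q%:C * q%:C ^+ i != 0 :> R[i].
  by rewrite -rmorphM reg.
have ab_reg i : 1 - a%:C * b%:C * q%:C ^+ 2 * q%:C ^+ i != 0 :> R[i].
  by rewrite -rmorphXn -!rmorphM reg // (abq2_lt1 q_bounds a_bounds b_bound).
have qC_neq0 : q%:C != 0 :> R[i] by rewrite fmorph_eq0 gt_eqF.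
have qC_gt0 : 0 < q%:C :> R[i] by rewrite ltcR.
have qC_lt1 : q%:C < 1 :> R[i] by rewrite ltcR.
have mass_gt0 := real_mass_gt0 q_bounds a_bounds b_bound.
have mass_cvg := real_mass_cvg q_bounds a_bounds b_bound.
split; first exact: alphaE.
apply: monic_orthogonal_explicit => //.
- exact: real_xi_reg.
- exact: (weight_form_definite qC_gt0 qC_lt1 mass_gt0 mass_cvg).
move=> m k ne_mk; apply/eqP; have := P_orth m k ne_mk.
rewrite (inner_product_form v qC_gt0 mass_cvg) => /eqP.
by rewrite scaler_eq0 (negbTE (mass_sum_neq0 mass_gt0 mass_cvg)).
Qed.
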